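(* Let $n\ge 3$ be an integer. For each element $X\in S_n^+$ its normal form is unique; that is, the tuple of integers $(k_1,\dots,k_{n-2})$ with $0\le k_j\le j+1$ for $j=1,\dots,n-2$ and $$X=y_{1,k_1}\cdot y_{2,k_2}\cdots y_{n-2,k_{n-2}}$$ is uniquely determined by $X$.
   Context: For an integer $n\ge 2$, $S_n^+$ denotes the group given by generators $x_1,\dots,x_{n-2}$ and the defining relations (R1) $x_i^3=1$ for $1\le i\le n-2$; (R2) $(x_ix_{i+1})^2=1$ for $1\le i\le n-3$; (R3) $x_ix_j=x_jx_i$ for $1\le i,j\le n-2$ with $|i-j|>2$; (R4) $x_ix_{i+1}^{-1}x_{i+2}=x_{i+2}x_i$ for $1\le i\le n-4$. (A family of relations with empty index range is vacuous.) For $1\le m\le n-2$ and $0\le k\le m+1$ define the following elements of $S_n^+$: $y_{m,0}=x_m x_{m-1}\cdots x_2 x_1^2$; $\ y_{m,k}=x_mx_{m-1}\cdots x_k$ for $1\le k\le m$; $\ y_{m,m+1}=\mathrm{id}$. In particular $y_{1,0}=x_1^2$, $y_{1,1}=x_1$, $y_{1,2}=\mathrm{id}$. A normal form of $X\in S_n^+$ is a representation $X=y_{1,k_1}y_{2,k_2}\cdots y_{n-2,k_{n-2}}$ with integers $0\le k_j\le j+1$. *)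

(* Defs.v *)
(* Classical logic (boolp) is only used to make the congruence
   defined by a presentation boolean, so that one can form its quotient. *)
From HB Require Import structures.
From mathcomp Require Import all_boot.
#[warning="-notation-overridden"]
From mathcomp Require Import boolp.

Set Implicit Arguments.
Unset Strict Implicit.
Unset Printing Implicit Defensive.

Local Open Scope group_scope.
Local Open Scope quotient_scope.

(* Words in the letters i and i^-1 (i : I); [(i, b)] is i^-1 when b = true. *)
Notation word I := (seq (I * bool)).

Definition pos (I : Type) (i : I) : I * bool := (i, false).
Definition neg (I : Type) (i : I) : I * bool := (i, true).

Definition letter_inv (I : Type) (a : I * bool) : I * bool := (a.1, ~~ a.2).

Definition word_inv (I : Type) (w : word I) : word I :=
  rev [seq letter_inv a | a <- w].

(* The congruence on words generated by free cancellation and the relations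
   l = r such that R l r. *)
Inductive pres_eq (I : Type) (R : word I -> word I -> Prop) :
    word I -> word I -> Prop :=
| pres_eq_rel u v l r : R l r -> pres_eq R (u ++ l ++ v) (u ++ r ++ v)
| pres_eq_cancel u v a : pres_eq R (u ++ a :: letter_inv a :: v) (u ++ v)
| pres_eq_refl u : pres_eq R u u
| pres_eq_sym u v : pres_eq R u v -> pres_eq R v u
| pres_eq_trans v u w : pres_eq R u v -> pres_eq R v w -> pres_eq R u w.

Definition pres_eqb (I : choiceType) (R : word I -> word I -> Prop) :
  rel (word I) := fun u v => `[< pres_eq R u v >].

Lemma pres_eqb_refl (I : choiceType) (R : word I -> word I -> Prop) :
  reflexive (pres_eqb R).
Proof. by move=> u; apply/asboolP; exact: pres_eq_refl. Qed.

Lemma pres_eqb_sym (I : choiceType) (R : word I -> word I -> Prop) :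
  symmetric (pres_eqb R).
Proof. by move=> u v; apply/asboolP/asboolP; exact: pres_eq_sym. Qed.

Lemma pres_eqb_trans (I : choiceType) (R : word I -> word I -> Prop) :
  transitive (pres_eqb R).
Proof.
by move=> v u w /asboolP uv /asboolP vw; apply/asboolP/(pres_eq_trans uv).
Qed.

Canonical pres_equiv (I : choiceType) (R : word I -> word I -> Prop) :=
  EquivRel (pres_eqb R) (@pres_eqb_refl I R) (@pres_eqb_sym I R)
    (@pres_eqb_trans I R).

(* The group with generators I and relations R, as a quotient of words. *)
Definition pres_group (I : choiceType) (R : word I -> word I -> Prop) : Type :=
  {eq_quot (pres_equiv R)}.

HB.instance Definition _ (I : choiceType) (R : word I -> word I -> Prop) :=
  Choice.on (pres_group R).
HB.instance Definition _ (I : choiceType) (R : word I -> word I -> Prop) :=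
  Quotient.on (pres_group R).

Definition wclass (I : choiceType) (R : word I -> word I -> Prop)
  (w : word I) : pres_group R := \pi_(pres_group R) w.

Lemma wclassP (I : choiceType) (R : word I -> word I -> Prop) (u v : word I) :
  wclass R u = wclass R v <-> pres_eq R u v.
Proof.
split; first by move/(@eqmodP _ (pres_equiv R)) => /asboolP.
by move=> uv; apply/(@eqmodP _ (pres_equiv R))/asboolP.
Qed.

Lemma wclass_repr (I : choiceType) (R : word I -> word I -> Prop)
  (X : pres_group R) : wclass R (repr X) = X.
Proof. exact: reprK. Qed.

Lemma pres_eq_ctx (I : choiceType) (R : word I -> word I -> Prop)
  (u v s t : word I) :
  pres_eq R s t -> pres_eq R (u ++ s ++ v) (u ++ t ++ v).
Proof.
elim=> {s t} [a b l r lr | a b x | s | s t _ st | t s w _ st _ tw].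
- by have := pres_eq_rel (u ++ a) (b ++ v) lr; rewrite !catA.
- by have := pres_eq_cancel R (u ++ a) (b ++ v) x; rewrite -!catA.
- exact: pres_eq_refl.
- exact: pres_eq_sym.
- exact: pres_eq_trans st tw.
Qed.

Lemma pres_eq_cat (I : choiceType) (R : word I -> word I -> Prop)
  (u u' v v' : word I) :
  pres_eq R u u' -> pres_eq R v v' -> pres_eq R (u ++ v) (u' ++ v').
Proof.
move=> uu' vv'; apply: (@pres_eq_trans _ _ (u' ++ v)).
  exact: (pres_eq_ctx [::] v uu').
by have := pres_eq_ctx u' [::] vv'; rewrite !cats0.
Qed.

Lemma letter_invK (I : Type) : involutive (@letter_inv I).
Proof. by case=> i b; rewrite /letter_inv /= negbK. Qed.

Lemma pres_eq_invl (I : choiceType) (R : word I -> word I -> Prop)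
  (u : word I) : pres_eq R (word_inv u ++ u) [::].
Proof.
elim: u => [|a u IHu]; first exact: pres_eq_refl.
rewrite /word_inv /= rev_cons cat_rcons; apply: (pres_eq_trans _ IHu).
have := pres_eq_cancel R (word_inv u) u (letter_inv a).
by rewrite letter_invK.
Qed.

Definition pg_one (I : choiceType) (R : word I -> word I -> Prop) :
  pres_group R := wclass R [::].

Definition pg_inv (I : choiceType) (R : word I -> word I -> Prop)
  (X : pres_group R) : pres_group R := wclass R (word_inv (repr X)).

Definition pg_mul (I : choiceType) (R : word I -> word I -> Prop)
  (X Y : pres_group R) : pres_group R := wclass R (repr X ++ repr Y).

Lemma wclass_cat (I : choiceType) (R : word I -> word I -> Prop)
  (u v : word I) : wclass R (u ++ v) = pg_mul (wclass R u) (wclass R v).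
Proof.
by apply/wclassP/pres_eq_cat; apply/wclassP; rewrite wclass_repr.
Qed.

Lemma pg_mulA (I : choiceType) (R : word I -> word I -> Prop) :
  associative (@pg_mul I R).
Proof.
move=> X Y Z; rewrite -(wclass_repr X) -(wclass_repr Y) -(wclass_repr Z).
by rewrite -!wclass_cat catA.
Qed.

Lemma pg_mul1g (I : choiceType) (R : word I -> word I -> Prop) :
  left_id (pg_one R) (@pg_mul I R).
Proof. by move=> X; rewrite -(wclass_repr X) -wclass_cat. Qed.

Lemma pg_mulg1 (I : choiceType) (R : word I -> word I -> Prop) :
  right_id (pg_one R) (@pg_mul I R).
Proof. by move=> X; rewrite -(wclass_repr X) -wclass_cat cats0. Qed.

Lemma pg_mulVg (I : choiceType) (R : word I -> word I -> Prop) :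
  left_inverse (pg_one R) (@pg_inv I R) (@pg_mul I R).
Proof.
move=> X; rewrite -{2}(wclass_repr X) -wclass_cat.
exact/wclassP/pres_eq_invl.
Qed.

Lemma pg_mulgV (I : choiceType) (R : word I -> word I -> Prop) :
  right_inverse (pg_one R) (@pg_inv I R) (@pg_mul I R).
Proof.
move=> X; set Y := pg_inv X.
rewrite -[LHS]pg_mul1g -(pg_mulVg Y) -pg_mulA; congr pg_mul.
by rewrite pg_mulA pg_mulVg pg_mul1g.
Qed.

HB.instance Definition _ (I : choiceType) (R : word I -> word I -> Prop) :=
  isGroup.Build (pres_group R) (@pg_mulA I R) (@pg_mul1g I R) (@pg_mulg1 I R)
    (@pg_mulVg I R) (@pg_mulgV I R).

(* Indices 1, ..., n - 2 of the generators of S_n^+. *)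
Definition Sidx (n : nat) : Type := {i : nat | 1 <= i <= n - 2}.

HB.instance Definition _ (n : nat) := Choice.on (Sidx n).

Inductive Splus_rel (n : nat) : word (Sidx n) -> word (Sidx n) -> Prop :=
| SR1 (i : Sidx n) :
    Splus_rel [:: pos i; pos i; pos i] [::]
| SR2 (i j : Sidx n) : val j = (val i + 1)%N ->
    Splus_rel [:: pos i; pos j; pos i; pos j] [::]
| SR3 (i j : Sidx n) : (val i + 2 < val j) || (val j + 2 < val i) ->
    Splus_rel [:: pos i; pos j] [:: pos j; pos i]
| SR4 (i j k : Sidx n) : val j = (val i + 1)%N -> val k = (val i + 2)%N ->
    Splus_rel [:: pos i; neg j; pos k] [:: pos k; pos i].

(* The group S_n^+. *)
Definition Splus (n : nat) : Type := pres_group (@Splus_rel n).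

HB.instance Definition _ (n : nat) := Group.on (Splus n).

(* The generator x_i for 1 <= i <= n - 2; the value 1 at other i : nat is a
   dummy, never used below when m <= n - 2. *)
Definition Sx (n i : nat) : Splus n :=
  if insub i is Some j then wclass (@Splus_rel n) [:: pos (j : Sidx n)] else 1.

(* y_{m,k}; the product x_m x_{m-1} ... x_k is empty, hence 1, for k = m + 1. *)
Definition Sy (n m k : nat) : Splus n :=
  if k == 0 then (\prod_(i <- rev (index_iota 2 m.+1)) Sx n i) * Sx n 1 ^+ 2
  else \prod_(i <- rev (index_iota k m.+1)) Sx n i.

(* The tuple k = (k_1, ..., k_{n-2}) gives a normal form of X; [tnth k j] is
   k_{j+1}, as ordinals start at 0. *)
Definition is_normal_form (n : nat) (X : Splus n) (k : (n - 2).-tuple nat) :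
  Prop :=
  (forall j : 'I_(n - 2), tnth k j <= j.+1 + 1) /\
  X = \prod_(j < n - 2) Sy n j.+1 (tnth k j).

(* Main.v *)
(* Letting x_i act on the natural numbers as the 3-cycle (i i+1 i+2), with
   products applied from right to left, respects (R1)-(R4).  Under this action
   y_{m,k} sends k + 1 to m + 2 and fixes every point above m + 2.  Hence
   k_{n-2} + 1 is the preimage of n under X, and after cancelling the last
   factor one proceeds by induction. *)
Require Import Defs.
From mathcomp Require Import all_boot.
From mathcomp Require Import zify.

Local Open Scope group_scope.

Definition cyc3 (i x : nat) : nat :=
  if x == i then i.+1 else if x == i.+1 then i.+2 else
  if x == i.+2 then i else x.

(** Translation by [i] reduces each relation between these cycles to one between cycles starting at
    0, 1 or 2. *)
Lemma cyc3_add i a d : cyc3 (i + a) (i + d) = (i + cyc3 a d)%N.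
Proof. by rewrite /cyc3 -!addnS !eqn_add2l !(fun_if (addn i)). Qed.

Lemma cyc3_out i x : (x < i) || (i.+2 < x) -> cyc3 i x = x.
Proof. by rewrite /cyc3; do ?[case: ifP => ?]; lia. Qed.

Lemma cyc3_le i x : x <= i.+2 -> cyc3 i x <= i.+2.
Proof. by rewrite /cyc3; do ?[case: ifP => ?]; lia. Qed.

Lemma cyc3_ge i x : i <= x -> i <= cyc3 i x.
Proof. by rewrite /cyc3; do ?[case: ifP => ?]; lia. Qed.

Lemma cyc3K i x : cyc3 i (cyc3 i (cyc3 i x)) = x.
Proof.
(* Points below [i] are fixed. For [x = i + d], factoring out [i] leaves an identity in [d] alone:
   finitely many small values, and larger ones that are visibly fixed. *)
have [xi|/subnKC <-] := ltnP x i; first by rewrite !cyc3_out ?xi.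
move: (x - i)%N => d.
rewrite -{1 2 3}[i]addn0 !cyc3_add; congr addn.
by case: d => [|[|[|d]]].
Qed.

Lemma cyc3_R2 i x : cyc3 i (cyc3 i.+1 (cyc3 i (cyc3 i.+1 x))) = x.
Proof.
have [xi|/subnKC <-] := ltnP x i; first by do !rewrite cyc3_out; lia.
move: (x - i)%N => d.
rewrite -addn1 -{1 3}[i]addn0 !cyc3_add; congr addn.
by case: d => [|[|[|[|d]]]].
Qed.

(** The supports {i, i+1, i+2} and {j, j+1, j+2} are disjoint. *)
Lemma cyc3_comm i j x : i + 2 < j -> cyc3 i (cyc3 j x) = cyc3 j (cyc3 i x).
Proof.
move=> ij; have [xi|xi] := leqP x i.+2.
  have := cyc3_le i x xi => yi.
  by rewrite (cyc3_out j x) ?(cyc3_out j (cyc3 i x)) //; lia.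
rewrite (cyc3_out i x) ?xi ?orbT //; apply: cyc3_out.
have [/cyc3_ge|xj] := leqP j x; first lia.
by rewrite cyc3_out; lia.
Qed.

Lemma cyc3_R4 i x :
  cyc3 i (cyc3 i.+1 (cyc3 i.+1 (cyc3 i.+2 x))) = cyc3 i.+2 (cyc3 i x).
Proof.
have [xi|/subnKC <-] := ltnP x i; first by do !rewrite cyc3_out; lia.
move: (x - i)%N => d.
rewrite -addn2 -addn1 -{1 7}[i]addn0 !cyc3_add; congr addn.
by case: d => [|[|[|[|[|d]]]]].
Qed.

(** As the cycle has order 3, its square serves as the inverse. *)
Definition letter_act n (a : Sidx n * bool) (x : nat) : nat :=
  if a.2 then cyc3 (val a.1) (cyc3 (val a.1) x) else cyc3 (val a.1) x.

Definition word_act n (w : word (Sidx n)) (x : nat) : nat :=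
  foldr (@letter_act n) x w.

Lemma word_act_pres_eq n (u v : word (Sidx n)) :
  pres_eq (@Splus_rel n) u v -> word_act n u =1 word_act n v.
Proof.
elim=> {u v} [u v l r lr | u v [i b] | // | u v _ IH | u v w _ IHu _ IHv] x.
- rewrite /word_act !foldr_cat; congr foldr; move: (foldr _ x v) => {u v x} x.
  case: lr => [i | i j ij | i j ij | i j k ij ik]; rewrite /= /letter_act /=.
  + exact: cyc3K.
  + by rewrite ij addn1 cyc3_R2.
  + by case/orP: ij => ij; [|symmetry]; exact: cyc3_comm.
  + by rewrite ij ik addn1 addn2 cyc3_R4.
- rewrite /word_act !foldr_cat; congr foldr.
  by case: b; rewrite /= /letter_act /= cyc3K.
- by rewrite IH.
- by rewrite IHu IHv.
Qed.

Definition Splus_act n (X : Splus n) : nat -> nat := word_act n (repr X).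

Lemma Splus_act_wclass n (w : word (Sidx n)) :
  Splus_act n (wclass (@Splus_rel n) w) =1 word_act n w.
Proof. by apply: word_act_pres_eq; apply/wclassP; rewrite wclass_repr. Qed.

Lemma Splus_act1 n x : Splus_act n 1 x = x.
Proof. exact: (Splus_act_wclass n [::]). Qed.

Lemma Splus_actM n (X Y : Splus n) x :
  Splus_act n (X * Y) x = Splus_act n X (Splus_act n Y x).
Proof.
by rewrite [LHS](Splus_act_wclass n (repr X ++ repr Y)) /word_act foldr_cat.
Qed.

Lemma Splus_act_inj n (X : Splus n) : injective (Splus_act n X).
Proof.
apply: (can_inj (g := Splus_act n X^-1)) => x.
by rewrite -Splus_actM mulVg Splus_act1.
Qed.

Lemma Splus_act_Sx n i x : 1 <= i <= n - 2 -> Splus_act n (Sx n i) x = cyc3 i x.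
Proof. by move=> hi; rewrite /Sx insubT Splus_act_wclass. Qed.

(** No range for [i] is required: outside it [Sx n i] is the identity. *)
Lemma Splus_act_Sx_fix n i x : i.+2 < x -> Splus_act n (Sx n i) x = x.
Proof.
move=> ix; have [hi|hi] := boolP (1 <= i <= n - 2).
  by rewrite Splus_act_Sx // cyc3_out // ix orbT.
by rewrite /Sx insubN // Splus_act1.
Qed.

Lemma Splus_act_prod_fix n (I : Type) (r : seq I) (P : pred I)
    (F : I -> Splus n) x :
  (forall i, P i -> Splus_act n (F i) x = x) ->
  Splus_act n (\prod_(i <- r | P i) F i) x = x.
Proof.
move=> F_fix; apply: (big_ind (fun Y => Splus_act n Y x = x)) => //.
  exact: Splus_act1.
by move=> X Y hX hY; rewrite Splus_actM hY.
Qed.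

Lemma Splus_act_Sy_fix n m k x :
  1 <= m -> m.+2 < x -> Splus_act n (Sy n m k) x = x.
Proof.
move=> m_gt0 mx.
have fix_prod j : Splus_act n (\prod_(i <- rev (index_iota j m.+1)) Sx n i) x = x.
  rewrite big_seq; apply: Splus_act_prod_fix => i.
  rewrite mem_rev mem_index_iota => /andP[_ im].
  by apply: Splus_act_Sx_fix; lia.
rewrite /Sy; case: eqP => // _.
(* Since [m] is at least 1, [x] lies above 3, hence outside the support of x_1. *)
by rewrite Splus_actM expg2 Splus_actM !Splus_act_Sx_fix //; lia.
Qed.

(** Each x_i in turn meets its middle point i+1 and moves it to i+2, where x_{i+1} takes over. The
    bound [m] is exclusive, so [k = m] gives the empty product. *)
Lemma Splus_act_descending n k m : 1 <= k <= m -> m <= n - 2 + 1 ->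
  Splus_act n (\prod_(i <- rev (index_iota k m)) Sx n i) k.+1 = m.+1.
Proof.
case/andP=> k_gt0 /subnKC <-; elim: (m - k)%N => [|d IHd] kdn.
  by rewrite addn0 /index_iota subnn big_nil Splus_act1.
have ->: index_iota k (k + d.+1) = rcons (index_iota k (k + d)) (k + d).
  by rewrite /index_iota !addKn -addn1 iotaD cats1.
rewrite rev_rcons big_cons Splus_actM IHd; last lia.
rewrite Splus_act_Sx; last lia.
by rewrite /cyc3 eqxx; case: ifP; lia.
Qed.

Lemma Splus_act_Sy n m k : 1 <= m <= n - 2 -> k <= m.+1 ->
  Splus_act n (Sy n m k) k.+1 = m.+2.
Proof.
case/andP=> m_gt0 mn km; rewrite /Sy; case: eqP => [->|k_neq0].
  (* For [k = 0], x_1^2 sends 1 to 3, the starting point of the descending product that ends in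
     x_2. *)
  rewrite Splus_actM expg2 Splus_actM !Splus_act_Sx; try lia.
  by apply: (Splus_act_descending n 2 m.+1); lia.
by apply: Splus_act_descending; lia.
Qed.

(** Keeping [n] fixed and taking exponents as functions lets the induction on the number [N] of
    factors stay inside one group. *)
Lemma Sy_prod_inj n N (k k' : nat -> nat) : N <= n - 2 ->
  (forall j, j < N -> k j <= j.+2) -> (forall j, j < N -> k' j <= j.+2) ->
  \prod_(j < N) Sy n j.+1 (k j) = \prod_(j < N) Sy n j.+1 (k' j) ->
  forall j, j < N -> k j = k' j.
Proof.
elim: N => [//|N IHN] Nn kP k'P; rewrite !big_ord_recr /= => eq_prod.
have top (l : nat -> nat) : l N <= N.+2 ->
    Splus_act n (\prod_(j < N) Sy n j.+1 (l j) * Sy n N.+1 (l N)) (l N).+1 = N.+3.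
  move=> lN; rewrite Splus_actM Splus_act_Sy //.
  apply: Splus_act_prod_fix => j _; apply: Splus_act_Sy_fix => //.
  by rewrite !ltnS.
(* Both [(k N).+1] and [(k' N).+1] are preimages of [N.+3] under one injective action. *)
have kN : k N = k' N.
  have := top k' (k'P N (ltnSn N)); rewrite -eq_prod -(top k (kP N (ltnSn N))).
  by move/Splus_act_inj=> [].
move: eq_prod; rewrite kN => /mulIg eq_prod j.
rewrite ltnS leq_eqVlt => /orP[/eqP-> //|]; apply: IHN => //; first exact: ltnW.
- by move=> i iN; apply: kP; exact: ltnW.
- by move=> i iN; apply: k'P; exact: ltnW.
Qed.

Theorem corollary1 (n : nat) (hn : 3 <= n) (X : Splus n)
    (k k' : (n - 2).-tuple nat) :
  is_normal_form X k -> is_normal_form X k' -> k = k'.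
Proof.
have bound (l : (n - 2).-tuple nat) :
    (forall j : 'I_(n - 2), tnth l j <= j.+1 + 1) ->
    forall j, j < n - 2 -> nth 0 l j <= j.+2.
  by move=> lP j jn; have := lP (Ordinal jn); rewrite (tnth_nth 0) addn1.
(* The default 0 is never reached, as [j < n - 2]. *)
have prod_nth (l : (n - 2).-tuple nat) :
    \prod_(j < n - 2) Sy n j.+1 (tnth l j) =
    \prod_(j < n - 2) Sy n j.+1 (nth 0 l j).
  by apply: eq_bigr => j _; rewrite (tnth_nth 0).
move=> [kP Xk] [k'P Xk']; apply: eq_from_tnth => j; rewrite !(tnth_nth 0).
apply: (Sy_prod_inj n (n - 2)) => //; [exact: bound.. |].
by rewrite -!prod_nth -Xk.
Qed.
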